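(* Let $\mathbb{K}$ be a field of characteristic $0$. For a positive integer $r$, let $\mu(r)$ be the least integer $h$ such that $(1,r,h,r,1)$ is the Hilbert function of a standard graded Artinian Gorenstein $\mathbb{K}$-algebra, and let $\delta(r)=r-\mu(r)$. Then $\delta(24)=4$ and $\delta(40)=10$.
   Context: Standard graded Artinian Gorenstein algebras $Q/I$ are taken with $I$ containing no linear forms, so the codimension equals $h_1$. *)

(* Defs.v *)
From HB Require Import structures.
From mathcomp Require Import all_boot all_order all_algebra.
From mathcomp Require Import mpoly.
Set Implicit Arguments.
Unset Strict Implicit.
Unset Printing Implicit Defensive.
Import GRing.Theory.
Local Open Scope ring_scope.

Section GradedQuotients.
Variables (K : fieldType) (n : nat).
Implicit Types (I : {mpoly K[n]} -> Prop).

Definition is_ideal I : Prop :=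
  [/\ I 0,
      (forall p q, I p -> I q -> I (p + q)) &
      (forall p q, I p -> I (q * p))].

Definition is_homogeneous_ideal I : Prop :=
  is_ideal I /\ forall p d, I p -> I (pihomog mdeg d p).

(* dim_K (Q/I)_i = d : there are d forms of degree i whose classes form a
   K-basis of the degree-i component (Q/I)_i = Q_i / I_i. *)
Definition hilb_dim I (i d : nat) : Prop :=
  exists b : 'I_d -> {mpoly K[n]},
    [/\ (forall j, b j \is i.-homog),
        (forall c : 'I_d -> K, I (\sum_(j < d) c j *: b j) -> forall j, c j = 0) &
        (forall p, p \is i.-homog ->
           exists c : 'I_d -> K, I (p - \sum_(j < d) c j *: b j))].

(* Q/I is Artinian (finite-dimensional; for a graded quotient, its Hilbert
   function vanishes in high degree). *)
Definition is_artinian_quot I : Prop :=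
  exists D : nat, forall i, (D <= i)%N -> hilb_dim I i 0.

Definition socle_dim1 I : Prop :=
  exists s, [/\ ~ I s,
    (forall k : 'I_n, I ('X_k * s)) &
    (forall p, (forall k : 'I_n, I ('X_k * p)) -> exists c : K, I (p - c *: s))].

Definition is_graded_AG I : Prop :=
  [/\ is_homogeneous_ideal I, is_artinian_quot I & socle_dim1 I].

End GradedQuotients.

Definition AG_realizable (K : fieldType) (r h : nat) : Prop :=
  exists (n : nat) (I : {mpoly K[n]} -> Prop),
    is_graded_AG I /\
    forall i : nat, hilb_dim I i (nth 0%N [:: 1%N; r; h; r; 1%N] i).

Definition is_mu (K : fieldType) (r m : nat) : Prop :=
  AG_realizable K r m /\ forall h, AG_realizable K r h -> (m <= h)%N.

(* delta(r) = e, where delta(r) = r - mu(r)  (note mu(r) <= r). *)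
Definition is_delta (K : fieldType) (r e : nat) : Prop :=
  exists m, is_mu K r m /\ (e + m = r)%N.

(* Main.v *)
Require Import Defs.
From mathcomp Require Import all_boot all_order all_algebra.
From mathcomp Require Import mpoly.
From Stdlib Require Import ClassicalEpsilon.
From mathcomp Require Import zify ring.
Set Implicit Arguments.
Unset Strict Implicit.
Unset Printing Implicit Defensive.
Import GRing.Theory.

(* Upper bound: the form [F = \sum_g x_g y^g] of degree 4, where [g] runs over
   the cubic monomials in [m] variables [y], has one new variable [x_g] per [g];
   the quotient by its annihilator is the trivial extension of
   [K[y]/(y)^4] by its dual, and [m = 4, 5] gives (1,24,20,24,1) and
   (1,40,30,40,1).

   Lower bound: let [L] be a general linear form on a Gorenstein algebra [A] with
   Hilbert function (1,r,h,r,1).  Multiplication by [L] on [A_1] and on [A_2] are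
   adjoint for the perfect pairings into [A_4], so they have the same rank and
   [dim (A/L)_3 - dim (A/L)_2 = r - h].  Green's hyperplane restriction theorem
   bounds [dim (A/L)_3] and Macaulay's theorem bounds the growth of [A/L] from
   degree 2 to degree 3; for small [h] the two bounds are incompatible. *)

Local Open Scope ring_scope.

(** * Generic linear forms *)

Section Generic.
Variables (K : fieldType) (charK0 : [pchar K] =i pred0).

(** In characteristic 0 the integers below [size p] are distinct in [K], and they outnumber the
    roots of [p]. *)
Lemma poly_neq0_nonroot (p : {poly K}) : p != 0 -> exists t, p.[t] != 0.
Proof.
move=> p0; pose s := [seq i%:R : K | i <- iota 0 (size p)].
have us : uniq s.
  rewrite map_inj_uniq ?iota_uniq // => i j /eqP.
  wlog le_ij : i j / (i <= j)%N => [H|].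
    case/orP: (leq_total i j) => le_ij; first exact: H.
    by rewrite eq_sym => /eqP E; apply/esym; move/eqP: E; exact: H.
  rewrite eq_sym -subr_eq0 -natrB // => /eqP E.
  have := (pcharf0P K).1 charK0 (j - i)%N; rewrite E eqxx; lia.
case E: (all (root p) s).
  by have := max_poly_roots p0 E us; rewrite size_map size_iota ltnn.
by have /allPn[t _ nt] := negbT E; exists t.
Qed.

(* The only trace of Zariski openness that is needed: openness along lines. *)
Definition line_open w (P : 'rV[K]_w -> Prop) :=
  forall u v t0, P (u + t0 *: v) ->
  exists2 p : {poly K}, p != 0 & forall t, p.[t] != 0 -> P (u + t *: v).

(** On the line through [u] (at [t = 0]) and [v] (at [t = 1]), each property can fail only at the
    roots of a nonzero polynomial. *)
Lemma line_open_meet w (P Q : 'rV[K]_w -> Prop) :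
  line_open P -> line_open Q -> (exists u, P u) -> (exists v, Q v) ->
  exists h, P h /\ Q h.
Proof.
move=> oP oQ [u Pu] [v Qv].
have [|p p0 pP] := oP u (v - u) 0; first by rewrite scale0r addr0.
have [|q q0 qQ] := oQ u (v - u) 1; first by rewrite scale1r addrC subrK.
have [|t] := @poly_neq0_nonroot (p * q); first by rewrite mulf_neq0.
rewrite hornerM mulf_eq0 negb_or => /andP[pt qt].
by exists (u + t *: (v - u)); split; [apply: pP|apply: qQ].
Qed.

Lemma line_openI w (P Q : 'rV[K]_w -> Prop) :
  line_open P -> line_open Q -> line_open (fun h => P h /\ Q h).
Proof.
move=> oP oQ u v t0 [/oP[p p0 pP] /oQ[q q0 qQ]].
exists (p * q) => [|t]; first by rewrite mulf_neq0.
by rewrite hornerM mulf_eq0 negb_or => /andP[/pP ? /qQ ?].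
Qed.

(* [p.[t]] is a maximal minor of [A + t *: B], in suitable bases, equal to 1 at [t0]. *)
Lemma rank_pencil m n (A B : 'M[K]_(m, n)) t0 :
  exists2 p : {poly K}, p != 0 &
    forall t, p.[t] != 0 -> (\rank (A + t0 *: B)%R <= \rank (A + t *: B)%R)%N.
Proof.
set C := A + t0 *: B; set r := \rank C.
pose P : 'M_(r, m) := pid_mx r *m invmx (col_ebase C).
pose Q : 'M_(n, r) := invmx (row_ebase C) *m pid_mx r.
have PCQ : P *m C *m Q = 1%:M.
  transitivity (P *m (col_ebase C *m pid_mx r *m row_ebase C) *m Q); first by rewrite mulmx_ebase.
  rewrite /P /Q !mulmxA mulmxKV ?col_ebase_unit // mulmxK ?row_ebase_unit //.
  by rewrite !pid_mx_id ?rank_leq_row ?rank_leq_col ?pid_mx_1.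
pose N := map_mx polyC (1%:M : 'M[K]_r) + ('X - t0%:P) *: map_mx polyC (P *m B *m Q).
have evN t : (\det N).[t] = \det (P *m (A + t *: B) *m Q).
  rewrite -horner_evalE -det_map_mx; congr (\det _).
  have -> : A + t *: B = C + (t - t0) *: B.
    by rewrite /C -addrA -scalerDl [t0 + _]addrC subrK.
  rewrite mulmxDr mulmxDl PCQ -scalemxAr -scalemxAl.
  rewrite /N; move: (P *m B *m Q) => D.
  by apply/matrixP => i j; rewrite !mxE /= horner_evalE !hornerE.
exists (\det N) => [|t].
  apply: contraTneq isT => E; have := evN t0; rewrite E horner0 -/C PCQ det1.
  by move/eqP; rewrite eq_sym oner_eq0.
rewrite evN -unitfE -unitmxE => U.
apply: (@leq_trans (\rank (P *m (A + t *: B)%R *m Q))); first by rewrite (mxrank_unit U).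
by apply: leq_trans (mxrankM_maxl _ _) _; apply: mxrankM_maxr.
Qed.

Lemma line_open_rank w m n (F : 'rV[K]_w -> 'M[K]_(m, n)) k :
  linear F -> line_open (fun h => (k <= \rank (F h))%N).
Proof.
move=> linF u v t0.
have E t : F (u + t *: v) = F u + t *: F v by rewrite addrC linF addrC.
rewrite E => le_k; have [p p0 pP] := rank_pencil (F u) (F v) t0.
by exists p => // t /pP; rewrite E; apply: leq_trans.
Qed.

Lemma max_rank_exists w m n (F : 'rV[K]_w -> 'M[K]_(m, n)) :
  exists g, forall h, (\rank (F h) <= \rank (F g))%N.
Proof.
suff H k : forall g, (m - \rank (F g) <= k)%N ->
    exists g, forall h, (\rank (F h) <= \rank (F g))%N by exact: (H _ 0 (leqnn _)).
elim: k => [|k IH] g le_k.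
  by exists g => h; have := rank_leq_row (F h); lia.
case: (excluded_middle_informative (forall h, (\rank (F h) <= \rank (F g))%N)).
  by exists g.
move/not_all_ex_not => [h /negP]; rewrite -ltnNge => lt_gh.
by apply: (IH h); have := rank_leq_row (F h); lia.
Qed.

(** [cokermx A] kills exactly the row space of [A], so [X *m cokermx A] has the rank of [X] modulo
    [A]. *)
Lemma rank_adds_coker m1 m2 n (A : 'M[K]_(m1, n)) (X : 'M[K]_(m2, n)) :
  \rank (A + X)%MS = (\rank A + \rank (X *m cokermx A))%N.
Proof.
have E := mxrank_sum_cap A X; have E' := mxrank_mul_ker X (cokermx A).
suff : \rank (X :&: kermx (cokermx A))%MS = \rank (A :&: X)%MS by lia.
apply/eqP; rewrite eqn_leq; apply/andP; split; apply: mxrankS; rewrite sub_capmx.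
  by rewrite capmxSl andbT submxE; apply/eqP/sub_kermxP; exact: capmxSr.
rewrite capmxSr /=; apply/sub_kermxP/eqP; rewrite -submxE; exact: capmxSl.
Qed.

End Generic.

(** * The theorems of Green and Macaulay *)

Section GreenMacaulay.
Variables (K : fieldType) (charK0 : [pchar K] =i pred0) (w : nat) (d : nat -> nat).
(* [M i h] is the matrix of multiplication by the linear form [h] from degree
   [i] to degree [i+1]; vectors are rows, subspaces are row spaces. *)
Variable M : forall i, 'rV[K]_w -> 'M[K]_(d i, d i.+1).
Hypothesis linM : forall i, linear (M i).
Hypothesis comM : forall i g h, M i g *m M i.+1 h = M i h *m M i.+1 g.
(** Dual way of saying that the algebra is generated in degree 1: the images of all [M i h] together
    span degree [i+1]. *)
Hypothesis genM : forall i p (C : 'M[K]_(d i.+1, p)), (forall h, M i h *m C = 0) -> C = 0.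

Local Notation codim I := (\rank (cokermx I)).

Lemma codim_adds n m (I : 'M[K]_n) (X : 'M[K]_(m, n)) :
  (codim (I + X)%MS + \rank (X *m cokermx I) = codim I)%N.
Proof.
rewrite !mxrank_coker; have := rank_adds_coker I X.
have := rank_leq_col I; have := rank_leq_col (I + X)%MS; lia.
Qed.

Lemma linMC i p (C : 'M[K]_(d i.+1, p)) : linear (fun h => M i h *m C).
Proof. by move=> a u v; rewrite linM mulmxDl scalemxAl. Qed.

(* The linear form [g] maps a quotient of degree [n+1] onto the kernel of
   [A/(I,h) -> A/(I,g,h)] in degree [n+2]. *)
Lemma codim_hyperplane_split n (I : 'M[K]_(d n.+2)) g h :
  (codim (I + M n.+1 h)%MS <= codim ((I + M n.+1 g) + M n.+1 h)%MS +
    codim (kermx (M n.+1 g *m cokermx I) + M n h)%MS)%N.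
Proof.
set H := (I + M n.+1 h)%MS.
have <- : \rank (cokermx (H + M n.+1 g)%MS) =
          \rank (cokermx ((I + M n.+1 g) + M n.+1 h)%MS).
  by rewrite !mxrank_coker /H -!addsmxA (addsmxC (M n.+1 h)).
rewrite -(codim_adds H (M n.+1 g)) leq_add2l.
rewrite [leqRHS]mxrank_coker leq_subRL ?rank_leq_col //.
apply: mulmx0_rank_max; apply/eqP; rewrite mulmxA -submxE.
have IH : (I <= H)%MS := addsmxSl _ _.
rewrite addsmxMr addsmx_sub; apply/andP; split.
  apply: submx_trans IH; rewrite submxE -mulmxA mulmx_ker //.
rewrite comM; apply: submx_trans (addsmxSr _ _); exact: submxMl.
Qed.

(** [G n a] stands for Green's bound in degree [n]; [G1] and [GS] abstract the arithmetic of
    binomial expansions, on a bounded range so that a finite computation can establish them. *)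
Variables (G : nat -> nat -> nat) (D N : nat).
Hypothesis G1 : forall a, (a <= N -> a.-1 <= G 1 a)%N.
Hypothesis GS : forall n a c, (n < D -> a <= N -> c < a ->
  c <= G n.+1 (a - c) + G n.+2 c -> c <= G n.+2 a)%N.

(** Double induction, on the degree and on [codim I]. For a general [h], passing to [I + (g)] and to
    the colon [I : g] gives an inequality between [codim I] and the restricted codimension alone,
    which [GS] resolves. *)
Theorem green_restriction n (I : 'M[K]_(d n.+1)) : (n <= D)%N -> (codim I <= N)%N ->
  exists h, (codim (I + M n h)%MS <= G n.+1 (codim I))%N.
Proof.
have drop i (J : 'M[K]_(d i.+1)) : (0 < codim J)%N ->
    exists h, (0 < \rank (M i h *m cokermx J))%N.
  move=> J0; apply: NNPP => nex; move: J0; rewrite lt0n mxrank_eq0 => /eqP[].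
  apply: genM => h; apply/eqP; rewrite -mxrank_eq0 -leqn0 leqNgt; apply/negP => hh.
  by apply: nex; exists h.
elim: n I => [|n IHn] I le_D.
  have [/drop[h h0] le_N|] := ltnP 0%N (codim I).
    by exists h; have := codim_adds I (M 0 h); have := G1 le_N; lia.
  by exists 0; have := codim_adds I (M 0 0); lia.
have [a] := ubnP (codim I); elim: a I => // a IHa I /ltnSE le_a le_N.
have [I0|I0] := ltnP 0%N (codim I); last first.
  by exists 0; have := codim_adds I (M n.+1 0); lia.
have [g maxg] := max_rank_exists (fun h => M n.+1 h *m cokermx I).
set rho := \rank (M n.+1 g *m cokermx I) in maxg.
have rho_gt0 : (0 < rho)%N by have [h h0] := drop _ _ I0; exact: leq_trans h0 (maxg h).
set J := (I + M n.+1 g)%MS; have EJ : (codim J + rho = codim I)%N := codim_adds _ _.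
have [h2 Jh2] : exists h, (codim (J + M n.+1 h)%MS <= G n.+2 (codim J))%N.
  by apply: IHa; lia.
(* [L] is the colon space [I : g], one degree lower, where the induction on the degree applies. *)
set L := kermx (M n.+1 g *m cokermx I).
have EL : codim L = rho.
  by rewrite mxrank_coker mxrank_ker subKn // rank_leq_row.
have [h3 Lh3] : exists h, (codim (L + M n h)%MS <= G n.+1 rho)%N.
  by rewrite -EL; apply: IHn; lia.
have op i p (C : 'M[K]_(d i.+1, p)) h0 :
  line_open (fun h => (\rank (M i h0 *m C) <= \rank (M i h *m C))%N).
  by apply: line_open_rank; apply: linMC.
(* Each rank condition is line-open and holds somewhere, so one [h] satisfies all three. *)
have [h [[h_g h_2] h_3]] := line_open_meet charK0
  (line_openI (op _ _ (cokermx I) g) (op _ _ (cokermx J) h2)) (op _ _ (cokermx L) h3)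
  (line_open_meet charK0 (op _ _ (cokermx I) g) (op _ _ (cokermx J) h2)
     (ex_intro _ g (leqnn _)) (ex_intro _ h2 (leqnn _)))
  (ex_intro _ h3 (leqnn _)).
exists h; have Ih := codim_adds I (M n.+1 h).
have Jh := codim_adds J (M n.+1 h); have Jh2' := codim_adds J (M n.+1 h2).
have Lh := codim_adds L (M n h); have Lh3' := codim_adds L (M n h3).
have split_h := codim_hyperplane_split I g h; rewrite -/J -/L in split_h.
(* Maximality of [rho] forces [h] to have rank exactly [rho], so [I + (h)] has the codimension of
   [J]. *)
apply: GS => //; first by have := maxg h; lia.
have -> : (codim I - codim (I + M n.+1 h)%MS)%N = rho.
  by have := maxg h; lia.
have -> : codim (I + M n.+1 h)%MS = codim J by have := maxg h; lia.
have := maxg h; lia.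
Qed.

Variable Mac : nat -> nat -> nat.
Hypothesis MacS : forall n a c, (n <= D -> a <= N -> 0 < a -> c <= G n.+1 a ->
  c < a /\ a + Mac n.+1 c <= Mac n.+1 a)%N.

(** Macaulay's bound follows from Green's: for the [l] given by Green's theorem, [codim I'] is at
    most [codim I], which bounds the rank of [l], plus the codimension of [I' + (l)], to which
    induction applies. *)
Theorem macaulay_growth n (I : 'M[K]_(d n.+1)) (I' : 'M[K]_(d n.+2)) :
  (forall h, (I *m M n.+1 h <= I')%MS) -> (n <= D)%N -> (codim I <= N)%N ->
  (codim I' <= Mac n.+1 (codim I))%N.
Proof.
have [a] := ubnP (codim I); elim: a I I' => // a IHa I I' /ltnSE le_a II' le_D le_N.
have [I0|I0] := ltnP 0%N (codim I); last first.
  have -> : cokermx I' = 0; last by rewrite mxrank0.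
  apply: genM => h; apply/eqP; rewrite -submxE; apply: submx_trans (II' h).
  rewrite -[X in (X <= _)%MS]mul1mx; apply: submxMr.
  by rewrite submxE mul1mx -mxrank_eq0 -leqn0.
have [l Il] := green_restriction le_D le_N; have [lt_a leMac] := MacS le_D le_N I0 Il.
apply: leq_trans leMac; set H := (I + M n l)%MS in Il lt_a *.
have H' h : (H *m M n.+1 h <= I' + M n.+1 l)%MS.
  rewrite addsmxMr addsmx_sub (submx_trans (II' h)) ?addsmxSl //= comM.
  apply: submx_trans (addsmxSr _ _); exact: submxMl.
have := IHa H _ ltac:(lia) H' le_D ltac:(lia); have := codim_adds I' (M n.+1 l).
have : (\rank (M n.+1 l *m cokermx I') <= codim I)%N; last by lia.
rewrite [leqRHS]mxrank_coker leq_subRL ?rank_leq_col //.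
apply: mulmx0_rank_max; apply/eqP; rewrite mulmxA -submxE; exact: II'.
Qed.

End GreenMacaulay.

(** * Quotients by homogeneous ideals *)

Section IdealClosure.
Variables (K : fieldType) (n : nat) (I : {mpoly K[n]} -> Prop).
Hypothesis idI : is_ideal I.

Lemma idealZ c p : I p -> I (c *: p).
Proof. by case: idI => _ _ mulI /(mulI _ c%:MP); rewrite mul_mpolyC. Qed.

Lemma idealB p q : I p -> I q -> I (p - q).
Proof. by case: idI => _ addI _ Ip Iq; apply: addI => //; rewrite -scaleN1r; apply: idealZ. Qed.

Lemma ideal_sum (J : finType) (F : J -> {mpoly K[n]}) :
  (forall j, I (F j)) -> I (\sum_j F j).
Proof. by case: idI => I0 addI _ IF; elim/big_ind: _. Qed.

Lemma ideal_congr p q : I (p - q) -> I p <-> I q.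
Proof.
case: idI => _ addI _ Ipq; split => [Ip|Iq]; last by rewrite -(subrK q p); apply: addI.
by rewrite -(subKr p q); apply: idealB.
Qed.

End IdealClosure.

(** * Coordinates in the graded pieces of a quotient *)

Section QuotientCoordinates.
Variables (K : fieldType) (n : nat) (I : {mpoly K[n]} -> Prop) (d : nat -> nat).
Hypotheses (idI : is_ideal I) (dI : forall i, hilb_dim I i (d i)).

Definition qbasis i : 'I_(d i) -> {mpoly K[n]} :=
  proj1_sig (constructive_indefinite_description _ (dI i)).

Local Notation comb i c := (\sum_(j < d i) (c : 'rV[K]_(d i)) 0 j *: qbasis j).

(** [I] is an arbitrary predicate, so coordinates are picked by [epsilon]; they are meaningful when
    [p] is a form of degree [i]. *)
Definition coord i p : 'rV[K]_(d i) :=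
  epsilon (inhabits 0) (fun c : 'rV[K]_(d i) => I (p - comb i c)).

Lemma qbasis_homog i (j : 'I_(d i)) : qbasis j \is i.-homog.
Proof. by rewrite /qbasis; case: constructive_indefinite_description => b []. Qed.

Lemma comb_homog i (c : 'rV_(d i)) : comb i c \is i.-homog.
Proof. by apply: rpred_sum => j _; apply: rpredZ; apply: qbasis_homog. Qed.

Lemma qbasis_free i (c : 'rV_(d i)) : I (comb i c) -> c = 0.
Proof.
rewrite /qbasis; case: constructive_indefinite_description => b [_ free _] /= Ic.
by apply/rowP => j; rewrite mxE (free (fun j => c 0 j)).
Qed.

Lemma coordP i p : p \is i.-homog -> I (p - comb i (coord i p)).
Proof.
move=> hp; apply: (epsilon_spec _ (fun c : 'rV[K]_(d i) => I (p - comb i c))).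
rewrite /qbasis; case: constructive_indefinite_description => b [_ _ gen] /=.
have [c Ic] := gen p hp; exists (\row_j c j).
by under eq_bigr do rewrite mxE.
Qed.

Lemma combD i a (u v : 'rV_(d i)) : comb i (a *: u + v) = a *: comb i u + comb i v.
Proof.
rewrite scaler_sumr -big_split; apply: eq_bigr => j _.
by rewrite !mxE scalerDl scalerA.
Qed.

Lemma coord_unique i p (c : 'rV_(d i)) :
  p \is i.-homog -> I (p - comb i c) -> coord i p = c.
Proof.
move=> hp Ic; apply/eqP; rewrite -subr_eq0; apply/eqP/qbasis_free.
rewrite addrC -scaleN1r combD scaleN1r addrC.
have := idealB idI Ic (coordP hp); congr I; ring.
Qed.

Lemma coord_linear i a p q : p \is i.-homog -> q \is i.-homog ->
  coord i (a *: p + q) = a *: coord i p + coord i q.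
Proof.
move=> hp hq; apply: coord_unique; first by rewrite rpredD ?rpredZ.
have [_ addI _] := idI.
have := addI _ _ (idealZ idI a (coordP hp)) (coordP hq); congr I; rewrite combD scalerBr; ring.
Qed.

Lemma coord_eq0 i p : p \is i.-homog -> coord i p = 0 <-> I p.
Proof.
move=> hp; have C := ideal_congr idI (coordP hp); split => [E|/C /qbasis_free //].
apply/C; rewrite E; have [I0 _ _] := idI.
by rewrite big1 // => j _; rewrite mxE scale0r.
Qed.

Lemma coord_congr i p q : p \is i.-homog -> q \is i.-homog -> I (p - q) ->
  coord i p = coord i q.
Proof.
move=> hp hq Ipq; apply: coord_unique => //.
have [_ addI _] := idI; have := addI _ _ Ipq (coordP hq).
by rewrite addrA subrK.
Qed.

Lemma coordZ i a p : p \is i.-homog -> coord i (a *: p) = a *: coord i p.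
Proof.
move=> hp; have := coord_linear a hp (dhomog0 _ _ _ : (0 : {mpoly K[n]}) \is i.-homog).
have [I0 _ _] := idI.
by rewrite (coord_eq0 (dhomog0 _ _ _)).2 // !addr0.
Qed.

Lemma coord_sum i (J : finType) (c : J -> K) (F : J -> {mpoly K[n]}) :
  (forall j, F j \is i.-homog) ->
  coord i (\sum_j c j *: F j) = \sum_j c j *: coord i (F j).
Proof.
move=> hF; pose P p (u : 'rV_(d i)) := p \is i.-homog /\ coord i p = u.
suff [] : P (\sum_j c j *: F j) (\sum_j c j *: coord i (F j)) by [].
elim/big_ind2: _ => [|p u q v [hp <-] [hq <-]|j _].
- split; first exact: dhomog0.
  by apply/(coord_eq0 (dhomog0 _ _ _)); case: idI.
- split; first exact: rpredD.
  by have := coord_linear 1 hp hq; rewrite !scale1r.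
- by split; [exact: rpredZ (hF j) | exact: coordZ (hF j)].
Qed.

Lemma coord_comb i (c : 'rV_(d i)) : coord i (comb i c) = c.
Proof.
by apply: coord_unique; [exact: comb_homog | rewrite subrr; case: idI].
Qed.

Lemma comb_delta i (l : 'I_(d i)) : comb i (delta_mx 0 l) = qbasis l.
Proof.
rewrite (bigD1 l) //= mxE !eqxx scale1r big1 ?addr0 // => j.
by rewrite mxE /= => /negPf ->; rewrite scale0r.
Qed.

Definition linform (h : 'rV[K]_n) : {mpoly K[n]} := \sum_k h 0 k *: 'X_k.

Lemma mpolyX_homog k : 'X_k \is [in K[n], 1.-homog].
Proof. by rewrite dhomogX /= mdeg1. Qed.

Lemma linform_homog h : linform h \is 1.-homog.
Proof. by apply: rpred_sum => k _; apply: rpredZ; apply: mpolyX_homog. Qed.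

Lemma linform_delta k : linform (delta_mx 0 k) = 'X_k.
Proof.
rewrite /linform (bigD1 k) //= mxE !eqxx scale1r big1 ?addr0 // => l.
by rewrite mxE /= => /negPf ->; rewrite scale0r.
Qed.

Lemma linform_mul_homog h i p : p \is i.-homog -> linform h * p \is i.+1.-homog.
Proof. exact: dhomogM (linform_homog h). Qed.

Definition mulmat i (h : 'rV[K]_n) : 'M[K]_(d i, d i.+1) :=
  \matrix_(j < d i) coord i.+1 (linform h * qbasis j).

Lemma coord_mul i h p : p \is i.-homog ->
  coord i.+1 (linform h * p) = coord i p *m mulmat i h.
Proof.
move=> hp; rewrite mulmx_sum_row.
transitivity (coord i.+1 (linform h * comb i (coord i p))).
  apply: coord_congr; try (apply: linform_mul_homog => //; exact: comb_homog).
  by rewrite -mulrBr; have [_ _ mulI] := idI; apply: mulI; apply: coordP.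
rewrite mulr_sumr; under eq_bigr do rewrite -scalerAr.
rewrite coord_sum => [|j]; last exact/linform_mul_homog/qbasis_homog.
by apply: eq_bigr => j _; rewrite rowK.
Qed.

Lemma mulmat_linear i : linear (mulmat i).
Proof.
move=> a g h; apply/row_matrixP => j; rewrite linearP /= !rowK.
rewrite -coord_linear; try exact/linform_mul_homog/qbasis_homog.
congr coord; rewrite scalerAl -mulrDl; congr (_ * _).
rewrite /linform scaler_sumr -big_split; apply: eq_bigr => k _.
by rewrite !mxE scalerDl scalerA.
Qed.

Lemma mulmat_comm i g h : mulmat i g *m mulmat i.+1 h = mulmat i h *m mulmat i.+1 g.
Proof.
have hb j := qbasis_homog (i := i) j.
apply/row_matrixP => j; rewrite !row_mul !rowK -!coord_mul ?linform_mul_homog //.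
by rewrite mulrCA.
Qed.

(** Every monomial of positive degree is a variable times a monomial of one degree less. *)
Lemma mulmat_generated i p (C : 'M[K]_(d i.+1, p)) :
  (forall h, mulmat i h *m C = 0) -> C = 0.
Proof.
move=> MC; apply/row_matrixP => l; rewrite row0.
suff H q : q \is i.+1.-homog -> coord i.+1 q *m C = 0.
  have := H _ (qbasis_homog l).
  by rewrite -[qbasis l]comb_delta coord_comb -rowE.
move=> hq; pose P r := r \is i.+1.-homog /\ coord i.+1 r *m C = 0.
suff [] : P q by [].
rewrite [q]mpolyE big_seq; elim/big_ind: _ => [|p1 p2 [h1 E1] [h2 E2]|m mq].
- split; first exact: dhomog0.
  by rewrite (coord_eq0 (dhomog0 _ _ _)).2 ?mul0mx //; case: idI.
- split; first exact: rpredD.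
  by have := coord_linear 1 h1 h2; rewrite !scale1r => ->; rewrite mulmxDl E1 E2 addr0.
have dm : mdeg m = i.+1 by apply: dhomogP hq m mq.
have [k mk] : exists k, m k != 0%N.
  apply/existsP; apply: contraTT isT => /existsPn m0.
  move: dm; rewrite mdegE big1 // => k _; have := m0 k; lia.
have Em : m = (U_(k) + (m - U_(k)))%MM by rewrite addmC submK // lep1mP.
have hX : 'X_[(m - U_(k))] \is [in K[n], i.-homog].
  by rewrite dhomogX /= -eqSS -dm {2}Em mdegD mdeg1.
have hXm : 'X_[m] \is [in K[n], (i.+1).-homog] by rewrite dhomogX /= dm.
split; first exact: rpredZ.
rewrite coordZ // {2}Em mpolyXD -linform_delta coord_mul //.
by rewrite -scalemxAl -mulmxA MC mulmx0 scaler0.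
Qed.

End QuotientCoordinates.

(** * The perfect pairing of a Gorenstein quotient into its top degree *)

Section GorensteinDuality.
Variables (K : fieldType) (n : nat) (I : {mpoly K[n]} -> Prop) (d : nat -> nat) (e : nat).
Hypotheses (homI : is_homogeneous_ideal I) (socI : socle_dim1 I).
Hypotheses (dI : forall i, hilb_dim I i (d i)) (de : d e = 1%N) (de1 : d e.+1 = 0%N).

Let idI : is_ideal I := proj1 homI.
Local Notation coord := (coord dI).
Local Notation mulmat := (mulmat dI).

(** A nonzero class in degree [e] lies in the socle because degree [e+1] vanishes, so it spans the
    socle; a socle form of another degree is a multiple of it, hence zero. *)
Lemma socle_degree i p : i != e -> p \is i.-homog -> (forall k, I ('X_k * p)) -> I p.
Proof.
move=> ie hp Xp; have [s [_ _ soc]] := socI; have [I0 addI mulI] := idI.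
have j0 : 'I_(d e) by rewrite de; exact: ord0.
pose t := qbasis dI j0; have ht : t \is e.-homog := qbasis_homog dI j0.
have tI : ~ I t.
  rewrite /t -comb_delta => /qbasis_free/rowP/(_ j0)/eqP.
  by rewrite !mxE !eqxx oner_eq0.
have [k|a It] := soc t.
  apply/(coord_eq0 idI dI (i := e.+1)).
    exact: dhomogM (mpolyX_homog _ _) ht.
  by apply/rowP => j; have := ltn_ord j; rewrite {2}de1.
have [b Ip] := soc p Xp.
have a0 : a != 0.
  by apply/eqP => a0; apply: tI; move: It; rewrite a0 scale0r subr0.
have : I (p - (b / a) *: t).
  have := idealB idI Ip (idealZ idI (b / a) It); congr I.
  by rewrite scalerBr scalerA divfK //; ring.
move/(homI.2 _ i); rewrite raddfB /= linearZ /= (pihomog_dE hp).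
by rewrite (pihomog_ne0 _ ht) ?scaler0 ?subr0 // eq_sym.
Qed.

(** If [p] pairs to zero with degree [k+1], each ['X_l * p] pairs to zero with degree [k]; by
    induction [p] is a socle form of degree below [e]. *)
Lemma pairing_nondeg k i p : (i + k)%N = e -> p \is i.-homog ->
  (forall q, q \is k.-homog -> I (p * q)) -> I p.
Proof.
elim: k i p => [|k IH] i p ik hp pq.
  by rewrite -[p]mulr1; apply: pq; exact: dhomog1.
apply: (@socle_degree i) => // [|l]; first by lia.
apply: (IH i.+1) => [||q hq]; first by lia.
  exact: dhomogM (mpolyX_homog _ _) hp.
rewrite mulrAC mulrC; apply: pq.
exact: dhomogM (mpolyX_homog _ _) hq.
Qed.

Let o : 'I_(d e) := cast_ord (esym de) ord0.

(** Gram matrix of the product into the one-dimensional degree [e]; meaningful when [i + k = e]. *)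
Definition pairing i k : 'M[K]_(d i, d k) :=
  \matrix_(j, l) coord e (qbasis dI j * qbasis dI l) 0 o.

Lemma coord_top_eq0 p : p \is e.-homog -> coord e p 0 o = 0 -> I p.
Proof.
move=> hp E; apply/(coord_eq0 idI dI hp)/rowP => j; rewrite mxE -[RHS]E.
congr (coord e p 0 _); apply: val_inj => /=; have := ltn_ord j; rewrite {2}de; lia.
Qed.

Lemma pairing_mull i k p l : (i + k)%N = e -> p \is i.-homog ->
  (coord i p *m pairing i k) 0 l = coord e (p * qbasis dI l) 0 o.
Proof.
move=> ik hp; have [_ _ mulI] := idI.
have hM r (l' : 'I_(d k)) : r \is i.-homog -> r * qbasis dI l' \is e.-homog.
  by move=> hr; rewrite -ik; apply: dhomogM => //; apply: qbasis_homog.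
have E : (\sum_(j < d i) coord i p 0 j *: qbasis dI j) * qbasis dI l =
    \sum_(j < d i) coord i p 0 j *: (qbasis dI j * qbasis dI l).
  by rewrite mulr_suml; apply: eq_bigr => j _; rewrite scalerAl.
rewrite (@coord_congr _ _ _ _ idI dI e (p * _)
  ((\sum_(j < d i) coord i p 0 j *: qbasis dI j) * qbasis dI l)).

- rewrite E (coord_sum idI) => [|j]; last by apply: hM; apply: qbasis_homog.
  by rewrite mxE summxE; apply: eq_bigr => j _; rewrite !mxE.
- exact: hM.
- by apply: hM; apply: comb_homog.
- by rewrite -mulrBl mulrC; apply: mulI; apply: coordP.
Qed.

Lemma pairing_tr i k : (pairing i k)^T = pairing k i.
Proof. by apply/matrixP => j l; rewrite !mxE mulrC. Qed.

Lemma pairing_row_free i k : (i + k)%N = e -> row_free (pairing i k).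
Proof.
move=> ik; apply: inj_row_free => v vB.
pose p := \sum_(j < d i) v 0 j *: qbasis dI j.
have hp : p \is i.-homog := comb_homog dI v.
apply: (qbasis_free (dI := dI)); apply: (pairing_nondeg ik hp) => q hq.
have [_ addI mulI] := idI.
rewrite -[q](subrK (\sum_(l < d k) coord k q 0 l *: qbasis dI l)) mulrDr.
apply: addI; first by apply: mulI; apply: coordP.
rewrite mulr_sumr; apply: (ideal_sum idI) => l.
rewrite -scalerAr; apply: (idealZ idI); apply: coord_top_eq0.
  by rewrite -ik; apply: dhomogM => //; apply: qbasis_homog.
by rewrite -(@pairing_mull i k) // /p (coord_comb idI) vB mxE.
Qed.

(** Both sides are the matrix of [(u, v) -> h u v] with values in degree [e]. *)
Lemma mulmat_adjoint i k h : (i + k).+1 = e ->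
  mulmat i h *m pairing i.+1 k = pairing i k.+1 *m (mulmat k h)^T.
Proof.
move=> ik; rewrite -(pairing_tr k.+1 i) -trmx_mul.
apply/matrixP => j l; rewrite [RHS]mxE.
have row_mulE a b (j' : 'I_(d a)) (l' : 'I_(d b)) : (a.+1 + b)%N = e ->
    (mulmat a h *m pairing a.+1 b) j' l' = coord e (linform h * qbasis dI j' * qbasis dI l') 0 o.
  move=> ab; rewrite -(@pairing_mull a.+1 b) //; last exact/linform_mul_homog/qbasis_homog.
  by rewrite [LHS]mxE [RHS]mxE; apply: eq_bigr => m _; rewrite [mulmat _ _ _ _]mxE.
rewrite !row_mulE; try lia.
by rewrite mulrAC.
Qed.

(** The pairings in the adjunction do not change the ranks; [d i = d k.+1] makes the right-hand one
    square, so row-free becomes row-full. *)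
Lemma mulmat_rank i k h : (i + k).+1 = e -> d i = d k.+1 ->
  \rank (mulmat i h) = \rank (mulmat k h).
Proof.
move=> ik dik.
have free1 : row_free (pairing i.+1 k) by apply: pairing_row_free; lia.
have full1 : row_full (pairing i k.+1).
  have /eqP : row_free (pairing i k.+1) by apply: pairing_row_free; lia.
  by rewrite /row_full => ->; rewrite dik.
rewrite -(mxrankMfree _ free1) mulmat_adjoint //.
by rewrite (eqmxMfull _ full1) mxrank_tr.
Qed.

End GorensteinDuality.

(** * The lower bound *)

Section BinomialExpansions.
Local Open Scope nat_scope.

(* [binomial_top n a a n] is the largest [k >= n] with ['C(k, n) <= a], for [0 < n] and [0 < a]. *)
Fixpoint binomial_top (n a fuel k : nat) : nat :=
  if fuel is f.+1 then
    if 'C(k.+1, n) <= a then binomial_top n a f k.+1 else k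
  else k.

(* If [a = 'C(k_n, n) + 'C(k_(n-1), n-1) + ...] is the [n]-binomial expansion,
   this is [a_<n> = 'C(k_n - 1, n) + 'C(k_(n-1) - 1, n-1) + ...]. *)
Fixpoint green_number (n a : nat) : nat :=
  if n is m.+1 then
    if a is 0 then 0 else
    let k := binomial_top n a a n in 'C(k.-1, n) + green_number m (a - 'C(k, n))
  else 0.

(* In the same notation, [a^<n> = 'C(k_n + 1, n + 1) + 'C(k_(n-1) + 1, n) + ...]. *)
Fixpoint macaulay_number (n a : nat) : nat :=
  if n is m.+1 then
    if a is 0 then 0 else
    let k := binomial_top n a a n in 'C(k.+1, n.+1) + macaulay_number m (a - 'C(k, n))
  else 0.

(** This and the next two lemmas check the numerical hypotheses exhaustively for degrees up to 3 and
    codimensions up to 40, the larger value of [r]. *)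
Lemma green_number1 a : a <= 40 -> a.-1 <= green_number 1 a.
Proof.
move=> le_a; have : all (fun b => b.-1 <= green_number 1 b) (iota 0 41) by vm_compute.
by move/allP; apply; rewrite mem_iota.
Qed.

Lemma green_numberS n a c : n < 2 -> a <= 40 -> c < a ->
  c <= green_number n.+1 (a - c) + green_number n.+2 c -> c <= green_number n.+2 a.
Proof.
move=> lt_n le_a lt_c; apply/implyP.
have : all (fun n => all (fun a => all (fun c =>
    (c <= green_number n.+1 (a - c) + green_number n.+2 c) ==> (c <= green_number n.+2 a))
  (iota 0 a)) (iota 0 41)) (iota 0 2) by vm_compute.
move/allP/(_ n); rewrite mem_iota => /(_ lt_n)/allP/(_ a).
by rewrite mem_iota => /(_ le_a)/allP; apply; rewrite mem_iota.
Qed.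

Lemma macaulay_numberS n a c : n <= 2 -> a <= 40 -> 0 < a -> c <= green_number n.+1 a ->
  c < a /\ a + macaulay_number n.+1 c <= macaulay_number n.+1 a.
Proof.
move=> lt_n le_a a0 le_c; apply/andP; move: a0; apply/implyP.
have : all (fun n => all (fun a => all (fun c =>
    (0 < a) ==> (c < a) && (a + macaulay_number n.+1 c <= macaulay_number n.+1 a))
  (iota 0 (green_number n.+1 a).+1)) (iota 0 41)) (iota 0 3) by vm_compute.
move/allP/(_ n); rewrite mem_iota => /(_ lt_n)/allP/(_ a).
by rewrite mem_iota => /(_ le_a)/allP; apply; rewrite mem_iota ltnS.
Qed.

End BinomialExpansions.

(* [c] and [x] are the dimensions of [A/LA] in degrees 3 and 2 for a general
   linear form [L]; they differ by [r - h] because multiplication by [L] on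
   [A_1] and on [A_2] are adjoint to each other. *)
Lemma AG_hyperplane_section (K : fieldType) r h : [pchar K] =i pred0 ->
  (r <= 40)%N -> (h <= 40)%N -> AG_realizable K r h ->
  exists c x, [/\ (c <= green_number 3 r)%N, (x + r = c + h)%N & (c <= macaulay_number 2 x)%N].
Proof.
move=> charK0 le_r le_h [n [I [[homI _ socI] dI]]].
pose d i := nth 0%N [:: 1%N; r; h; r; 1%N] i; have dI' : forall i, hilb_dim I i (d i) := dI.
have idI := proj1 homI.
pose M := mulmat dI'.
have linM := mulmat_linear idI dI'; have comM := mulmat_comm idI dI'.
have genM := @mulmat_generated _ _ _ _ idI dI'.
have E0 : \rank (cokermx (0 : 'M[K]_(d 3%N))) = r by rewrite mxrank_coker mxrank0 subn0.
(* The index is shifted: [n := 2] is degree 3, where the zero subspace has codimension [r]. *)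
have [||L] := green_restriction charK0 linM comM genM green_number1 green_numberS
  (n := 2%N) (I := 0) => //; first by rewrite E0.
rewrite E0 => leL.
have E3 := codim_adds (0 : 'M[K]_(d 3%N)) (M 2%N L).
pose J : 'M[K]_(d 2%N) := ((0 : 'M[K]_(d 2%N)) + M 1%N L)%MS.
have E2 := codim_adds (0 : 'M[K]_(d 2%N)) (M 1%N L).
(* Here [i = 1] and [k = 2]; degrees 1 and 3 both have dimension [r]. *)
have rkE : \rank (M 1%N L) = \rank (M 2%N L) by apply: (mulmat_rank (e := 4%N)).
exists (\rank (cokermx ((0 : 'M[K]_(d 3%N)) + M 2%N L)%MS)), (\rank (cokermx J)).
have H2 : \rank (cokermx (0 : 'M[K]_(d 2%N))) = h by rewrite mxrank_coker mxrank0 subn0.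
have rk0 i (X : 'M[K]_(d i, d i.+1)) : \rank (X *m cokermx (0 : 'M[K]_(d i.+1))) = \rank X.
  by rewrite mxrankMfree // -row_leq_rank mxrank_coker mxrank0 subn0.
rewrite !rk0 ?E0 ?H2 -?rkE in E2 E3; rewrite -/J in E2; split=> //; first by lia.
apply: (macaulay_growth charK0 linM comM genM green_number1 green_numberS macaulay_numberS) => //.
  move=> g; rewrite addsmxMr mul0mx addsmx_sub sub0mx /= comM.
  apply: submx_trans (addsmxSr _ _); exact: submxMl.
by lia.
Qed.

(** The boolean check says that for [h < m] no [c] within Green's bound satisfies Macaulay's;
    [x + r = c + h] keeps [x] in the range tested. *)
Lemma AG_lower_bound (K : fieldType) r m h : [pchar K] =i pred0 ->
  (r <= 40)%N -> (m <= 40)%N ->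
  all (fun c => all (fun h => all (fun x =>
    (x + r == c + h)%N ==> (macaulay_number 2 x < c)%N) (iota 0 (c + h).+1))
    (iota 0 m)) (iota 0 (green_number 3 r).+1) ->
  AG_realizable K r h -> (m <= h)%N.
Proof.
move=> charK0 le_r le_m chk AG; rewrite leqNgt; apply/negP => lt_h.
have [|c [x [le_c Ex le_mac]]] := AG_hyperplane_section charK0 le_r _ AG; first by lia.
move/allP: chk => /(_ c); rewrite mem_iota => /(_ le_c)/allP/(_ h).
rewrite mem_iota => /(_ lt_h)/allP/(_ x); rewrite mem_iota Ex eqxx.
rewrite [(macaulay_number _ _ < _)%N]ltnNge le_mac.
by move=> /(_ ltac:(lia)).
Qed.

(** * Inverse systems *)

Section InverseSystem.
Variables (K : fieldType) (n e : nat) (Phi : {mpoly K[n]} -> K).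
Hypothesis Phi_linear : forall a (p q : {mpoly K[n]}), Phi (a *: p + q) = a * Phi p + Phi q.
Hypothesis Phi_degree : forall p (i : nat), i != e -> p \is i.-homog -> Phi p = 0.
Hypothesis Phi_neq0 : exists2 s, s \is e.-homog & Phi s = 1.

(** The largest ideal inside the kernel of [Phi]: the annihilator, under contraction, of the form of
    degree [e] whose coefficients are the values of [Phi] on monomials. *)
Definition annihilator (p : {mpoly K[n]}) : Prop := forall q, Phi (q * p) = 0.

Lemma Phi0 : Phi 0 = 0.
Proof. by have := Phi_linear (-1) 0 0; rewrite scaler0 addr0 mulN1r addNr. Qed.

Lemma PhiZ a p : Phi (a *: p) = a * Phi p.
Proof. by rewrite -[a *: p]addr0 Phi_linear Phi0 addr0. Qed.

Lemma PhiD p q : Phi (p + q) = Phi p + Phi q.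
Proof. by rewrite -{1}[p]scale1r Phi_linear mul1r. Qed.

Lemma PhiB p q : Phi (p - q) = Phi p - Phi q.
Proof. by rewrite PhiD -scaleN1r PhiZ mulN1r. Qed.

Lemma Phi_sum (J : Type) (r : seq J) (F : J -> {mpoly K[n]}) :
  Phi (\sum_(j <- r) F j) = \sum_(j <- r) Phi (F j).
Proof. exact: (big_morph Phi PhiD Phi0). Qed.

Lemma annihilatorP p :
  (forall mu, Phi ('X_[mu] * p) = 0) -> annihilator p.
Proof.
move=> H q; rewrite [q]mpolyE mulr_suml Phi_sum big1 // => mu _.
by rewrite -scalerAl PhiZ H mulr0.
Qed.

Lemma mulX_homog mu (p : {mpoly K[n]}) i : p \is i.-homog -> 'X_[mu] * p \is (mdeg mu + i).-homog.
Proof. by apply: dhomogM; rewrite dhomogX. Qed.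

Lemma annihilator_homogP p i : p \is i.-homog ->
  (forall mu, (mdeg mu + i)%N = e -> Phi ('X_[mu] * p) = 0) -> annihilator p.
Proof.
move=> hp H; apply: annihilatorP => mu.
have [/eqP/H //|E] := boolP ((mdeg mu + i)%N == e).
exact: Phi_degree E (mulX_homog mu hp).
Qed.

Lemma annihilator_ideal : is_ideal annihilator.
Proof.
split=> [q|p q Ip Iq r|p q Ip r]; first by rewrite mulr0 Phi0.
  by rewrite mulrDr PhiD Ip Iq addr0.
by rewrite mulrA.
Qed.

(** Against a monomial of degree [e - i], [Phi] sees only the component of degree [i]. *)
Lemma annihilator_homogeneous : is_homogeneous_ideal annihilator.
Proof.
split; first exact: annihilator_ideal.
move=> p i Ip; apply: (annihilator_homogP (pihomogP _ _ _)) => mu Emu.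
have [k le_k] : exists k, (msize p <= k)%N /\ (i < k)%N.
  by exists (maxn (msize p) i.+1); split; lia.
have := Ip 'X_[mu]; rewrite {1}(pihomog_partitionE (mf := mdeg) le_k.1) mulr_sumr Phi_sum.
rewrite (bigD1 (Ordinal le_k.2)) //= big1 ?addr0 // => j ji.
apply: Phi_degree (mulX_homog _ (pihomogP _ _ _)); rewrite -Emu eqn_add2l.
by apply: contraNneq ji => ji; apply/eqP/val_inj.
Qed.

Lemma annihilator_gt p i : (e < i)%N -> p \is i.-homog -> annihilator p.
Proof. by move=> lt_ei hp; apply: (annihilator_homogP hp) => mu; lia. Qed.

Lemma annihilator_hilb0 i : (e < i)%N -> hilb_dim annihilator i 0.
Proof.
move=> lt_ei; exists (fun => 0); split=> [[]|c _ []|p hp] //.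
by exists (fun => 0); rewrite big_ord0 subr0; apply: annihilator_gt hp.
Qed.

(** Nonconstant monomials kill a socle element, so only the constant term of [q] contributes. *)
Lemma mulX_eq0 p q : (forall k : 'I_n, annihilator ('X_k * p)) ->
  Phi (q * p) = q@_0%MM * Phi p.
Proof.
move=> Xp; have Xmu mu : Phi ('X_[mu] * p) = (mu == 0%MM)%:R * Phi p.
  have [->|mu0] := eqVneq mu 0%MM; first by rewrite mpolyX0 !mul1r.
  have [k mk] : exists k, mu k != 0%N.
    apply/existsP; apply: contraNT mu0 => /existsPn H.
    by apply/eqP/mnmP => k; rewrite mnm0E; apply/eqP; have := H k; rewrite negbK.
  by rewrite -(@submK _ U_(k) mu) ?lep1mP // mpolyXD -mulrA Xp mul0r.
rewrite {1}[q]mpolyE mulr_suml Phi_sum.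
under eq_bigr do rewrite -scalerAl PhiZ Xmu mulrA.
rewrite -mulr_suml; congr (_ * _); rewrite [X in _ = X@_ _]mpolyE raddf_sum /=.
by apply: eq_bigr => mu _; rewrite mcoeffZ mcoeffX.
Qed.

Lemma annihilator_AG : is_graded_AG annihilator.
Proof.
have [s hs Phi_s] := Phi_neq0; split; first exact: annihilator_homogeneous.
  by exists e.+1 => i; apply: annihilator_hilb0.
have Xs k : annihilator ('X_k * s).
  by apply: (annihilator_gt (ltnSn e)); rewrite -add1n; apply: dhomogM => //; apply: mpolyX_homog.
exists s; split=> // [Is|p Xp].
  by have := Is 1; rewrite mul1r Phi_s => /eqP; rewrite oner_eq0.
exists (Phi p) => q.
by rewrite mulrBr PhiB -scalerAr PhiZ !mulX_eq0 // Phi_s mulr1 mulrC subrr.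
Qed.

(** Dual-basis criterion: pairing with [b'] makes [b] independent and reads off coordinates; by
    [span] every test monomial of complementary degree acts as zero or as some [b' u], so these
    coordinates determine the class. *)
Lemma annihilator_hilb (T : finType) (b b' : T -> {mpoly K[n]}) i :
  (forall t, b t \is i.-homog) ->
  (forall t u, Phi (b t * b' u) = (t == u)%:R) ->
  (forall mu, (mdeg mu + i)%N = e ->
    (forall p, p \is i.-homog -> Phi ('X_[mu] * p) = 0) \/
    exists u, forall p, p \is i.-homog -> Phi ('X_[mu] * p) = Phi (p * b' u)) ->
  hilb_dim annihilator i #|T|.
Proof.
move=> hb bb' span.
have Phi_comb (c : T -> K) u : Phi ((\sum_t c t *: b t) * b' u) = c u.
  rewrite mulr_suml Phi_sum (bigD1 u) //= big1 ?addr0 => [|t /negPf tu].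
    by rewrite -scalerAl PhiZ bb' eqxx mulr1.
  by rewrite -scalerAl PhiZ bb' tu mulr0.
have reindexE (c : 'I_#|T| -> K) :
    \sum_j c j *: b (enum_val j) = \sum_t c (enum_rank t) *: b t.
  rewrite (reindex (@enum_rank T)) /=; last exact: onW_bij (enum_rank_bij T).
  by apply: eq_bigr => t _; rewrite enum_rankK.
exists (fun j => b (enum_val j)); split=> [j|c Ic j|p hp]; first exact: hb.
  have := Ic (b' (enum_val j)); rewrite reindexE mulrC Phi_comb.
  by rewrite enum_valK.
exists (fun j => Phi (p * b' (enum_val j))); rewrite reindexE.
set q := \sum_t _; have hq : q \is i.-homog.
  by apply: rpred_sum => t _; apply: rpredZ; apply: hb.
apply: (annihilator_homogP (rpredB hp hq)) => mu /span[H|[u H]].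
  by apply: H; apply: rpredB.
by rewrite H ?rpredB // mulrBl PhiB Phi_comb enum_rankK subrr.
Qed.

End InverseSystem.

(** * The trivial extension of [K[y]/(y)^4] by its dual *)

Section TrivialExtension.
Variables (K : fieldType) (m' : nat).
Local Notation m := m'.+1.

Definition monomials k : seq 'X_{1..m} := [seq s2m t | t : k.-tuple 'I_m <- enum (basis m k)].

Lemma mem_monomials k (a : 'X_{1..m}) : (a \in monomials k) = (mdeg a == k).
Proof. by rewrite basis_cover. Qed.

Local Notation s := (size (monomials 3)).

(** Exponent of [y^a x^b], the variables [y] coming first. *)
Definition yx (a : 'X_{1..m}) (b : 'X_{1..s}) : 'X_{1..m + s} :=
  [multinom match split i with inl j => a j | inr j => b j end | i < m + s].

Lemma yxl a b j : yx a b (lshift _ j) = a j.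
Proof. by rewrite mnmE (unsplitK (inl j)). Qed.

Lemma yxr a b j : yx a b (rshift _ j) = b j.
Proof. by rewrite mnmE (unsplitK (inr j)). Qed.

Lemma yxP (mu : 'X_{1..m + s}) : exists a b, mu = yx a b.
Proof.
exists [multinom mu (lshift s j) | j < m], [multinom mu (rshift m j) | j < s].
by apply/mnmP => i; rewrite mnmE; case: splitP => j ij; rewrite mnmE; congr (mu _); apply: val_inj.
Qed.

Lemma yx_add a b a' b' : (yx a b + yx a' b')%MM = yx (a + a') (b + b').
Proof. by apply/mnmP => i; rewrite mnmDE !mnmE; case: split => j; rewrite mnmDE. Qed.

Lemma yx_inj a b a' b' : yx a b = yx a' b' -> a = a' /\ b = b'.
Proof.
move=> /mnmP E; split; apply/mnmP => j.
  by rewrite -(yxl a b) E yxl.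
by rewrite -(yxr a b) E yxr.
Qed.

Lemma yx_mdeg a b : mdeg (yx a b) = (mdeg a + mdeg b)%N.
Proof.
rewrite !mdegE big_split_ord /=.
by congr (_ + _)%N; apply: eq_bigr => j _; rewrite ?yxl ?yxr.
Qed.

(* The exponent of the variable [x_g] dual to the cubic monomial [y^g]. *)
Definition dualvar (g : 'X_{1..m}) : 'X_{1..s} :=
  [multinom (j == index g (monomials 3) :> nat) : nat | j < s].

Lemma dualvarE g (hg : mdeg g = 3) :
  exists2 j : 'I_s, dualvar g = U_(j)%MM & nth 0%MM (monomials 3) j = g.
Proof.
have mg : g \in monomials 3 by rewrite mem_monomials hg.
have lt_g : (index g (monomials 3) < s)%N by rewrite index_mem.
exists (Ordinal lt_g); last exact: nth_index.
by apply/mnmP => j; rewrite mnm1E mnmE eq_sym.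
Qed.

Lemma dualvar_surj j : exists2 g, mdeg g = 3 & dualvar g = U_(j)%MM.
Proof.
have hg : mdeg (nth 0%MM (monomials 3) j) = 3.
  by apply/eqP; rewrite -mem_monomials mem_nth.
exists (nth 0%MM (monomials 3) j) => //; apply/mnmP => k.
by rewrite mnm1E mnmE index_uniq ?uniq_basis // eq_sym.
Qed.

Lemma dualvar_mdeg g : mdeg g = 3 -> mdeg (dualvar g) = 1%N.
Proof. by case/dualvarE => j -> _; rewrite mdeg1. Qed.

Lemma dualvar_inj g g' : mdeg g = 3 -> mdeg g' = 3 -> dualvar g = dualvar g' -> g = g'.
Proof.
move=> /dualvarE[j -> <-] /dualvarE[j' -> <-] /eqP.
by rewrite eq_mnm1 => /eqP ->.
Qed.

(* Contraction against [\sum_g x_g y^g], the sum ranging over all cubic monomials. *)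
Definition dualform (p : {mpoly K[m + s]}) : K :=
  \sum_(g <- monomials 3) p@_(yx g (dualvar g)).

Lemma dualform_linear a p q : dualform (a *: p + q) = a * dualform p + dualform q.
Proof.
rewrite /dualform mulr_sumr -big_split; apply: eq_bigr => g _.
by rewrite mcoeffD mcoeffZ.
Qed.

Lemma dualformX a b :
  dualform 'X_[yx a b] = ((mdeg a == 3) && (b == dualvar a))%:R.
Proof.
have X0 g : g != a -> 'X_[yx a b]@_(yx g (dualvar g)) = 0 :> K.
  move=> ga; rewrite mcoeffX; case: eqP => // /yx_inj[E _].
  by rewrite E eqxx in ga.
have [da|da] := boolP (mdeg a == 3).
  rewrite /dualform (bigD1_seq a) ?uniq_basis ?mem_monomials //= big1 ?addr0.
    rewrite mcoeffX; congr (_%:R); case: eqP => [/yx_inj[_ ->]|E]; first by rewrite eqxx.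
    by symmetry; case: eqP => // E'; case: E; rewrite E'.
  by move=> g; apply: X0.
rewrite /dualform big1_seq // => g /andP[_]; rewrite mem_monomials => dg.
by apply: X0; apply: contraNneq da => <-.
Qed.

Lemma dualform_degree p (i : nat) : i != 4 -> p \is i.-homog -> dualform p = 0.
Proof.
move=> i4 hp; apply: big1_seq => g /andP[_]; rewrite mem_monomials => /eqP dg.
apply: dhomog_nemf_coeff hp _; rewrite /= yx_mdeg dg dualvar_mdeg //.
by rewrite eq_sym.
Qed.

Local Notation corner k := (U_(ord0) *+ k)%MM.

Definition monX (a : 'X_{1..m}) : 'X_{1..m + s} := yx a 0%MM.
(* [star a] is dual to [y^a] for the pairing [(p, q) |-> dualform (p * q)]; every
   way of completing [a] to a cubic gives the same class modulo the annihilator. *)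
Definition star (a : 'X_{1..m}) : 'X_{1..m + s} :=
  yx (corner (3 - mdeg a)) (dualvar (a + corner (3 - mdeg a))).

Lemma mdeg_corner (a : 'X_{1..m}) : (mdeg a <= 3)%N -> mdeg (a + corner (3 - mdeg a)) = 3.
Proof. by move=> da; rewrite mdegD mdegMn mdeg1 mul1n subnKC. Qed.

Lemma monX_mdeg a : mdeg (monX a) = mdeg a.
Proof. by rewrite yx_mdeg mdeg0 addn0. Qed.

Lemma star_mdeg a : (mdeg a <= 3)%N -> mdeg (star a) = (4 - mdeg a)%N.
Proof.
move=> da; rewrite yx_mdeg dualvar_mdeg ?mdeg_corner //.
by rewrite mdegMn mdeg1; lia.
Qed.

(** A nonzero [b] pushes the [y]-degree below 3; for [b = 0] the cubic [y]-part must match the index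
    of the [x] variable, and cancelling the power of the first variable gives [a = g]. *)
Lemma dualform_star_yx a b g : (mdeg g <= 3)%N -> (mdeg a + mdeg b)%N = mdeg g ->
  dualform 'X_[star g + yx a b] = ((a == g) && (b == 0%MM))%:R.
Proof.
move=> dg dab; rewrite yx_add dualformX; congr (nat_of_bool _)%:R.
have E : mdeg (corner (3 - mdeg g) + a) = (3 - mdeg g + mdeg a)%N.
  by rewrite mdegD mdegMn mdeg1 mul1n.
have [b0|b0] := eqVneq b 0%MM; last first.
  rewrite andbF E; apply/negP => /andP[/eqP da _].
  by move: b0; rewrite -mdeg_eq0; lia.
rewrite b0 addm0 andbT; move: dab; rewrite b0 mdeg0 addn0 => da.
have -> : mdeg (corner (3 - mdeg g) + a) == 3 by rewrite E; lia.
apply/eqP/eqP => [/dualvar_inj H|->]; last by rewrite addmC.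
apply: (@addIm _ (corner (3 - mdeg g))); rewrite H ?mdeg_corner //; first by rewrite addmC.
by rewrite E; lia.
Qed.

(** The dual form is linear in the variables [x]. *)
Lemma dualform_yx_gt1 a b c : (1 < mdeg b)%N -> dualform 'X_[yx a b + c] = 0.
Proof.
move=> b1; have [a' [b' ->]] := yxP c; rewrite yx_add dualformX.
case: eqP => //= /dualvar_mdeg da; case: eqP => //= E.
by move: da; rewrite -E mdegD; lia.
Qed.

Lemma dualform_mul_congr mu nu (i : nat) (p : {mpoly K[m + s]}) : p \is i.-homog ->
  (forall la, mdeg la = i -> dualform 'X_[mu + la] = dualform 'X_[nu + la]) ->
  dualform ('X_[mu] * p) = dualform ('X_[nu] * p).
Proof.
move=> hp H; rewrite [p]mpolyE !mulr_sumr !(Phi_sum dualform_linear).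
apply: eq_big_seq => la /(dhomog_mf hp) dla.
by rewrite -!scalerAr !(PhiZ dualform_linear) -!mpolyXD H.
Qed.

Lemma dualform_mul_eq0 mu (i : nat) (p : {mpoly K[m + s]}) : p \is i.-homog ->
  (forall la, mdeg la = i -> dualform 'X_[mu + la] = 0) -> dualform ('X_[mu] * p) = 0.
Proof.
move=> hp H; rewrite [p]mpolyE !mulr_sumr !(Phi_sum dualform_linear).
apply: big1_seq => la /(dhomog_mf hp) dla.
by rewrite -!scalerAr !(PhiZ dualform_linear) -!mpolyXD H ?mulr0.
Qed.

(** Monomial basis of the degree-[k] part of [K[y]/(y)^4]. *)
Definition low_monomials k := if (k <= 3)%N then monomials k else [::].

Lemma mem_low k a : (a \in low_monomials k) = (mdeg a == k) && (k <= 3)%N.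
Proof.
by rewrite /low_monomials; case: ifP => _; rewrite ?mem_monomials ?andbT ?in_nil ?andbF.
Qed.

(** A basis in degree [i] consists of the [y^a] with [a] of degree [i] and the [star a] with [a] of
    degree [4 - i]; the dual family exchanges the two kinds. *)
Lemma trivial_extension_hilb i : (i <= 4)%N ->
  hilb_dim (annihilator dualform) i (size (low_monomials i) + size (low_monomials (4 - i))).
Proof.
move=> le_i; set B := low_monomials i; set B' := low_monomials (4 - i).
have uB k : uniq (low_monomials k).
  by rewrite /low_monomials; case: ifP => // _; apply: uniq_basis.
pose T := (seq_sub B + seq_sub B')%type.
have <- : #|{: T}| = (size B + size B')%N by rewrite card_sum !card_seq_sub ?uB.
have inB (t : seq_sub B) : mdeg (val t) = i /\ (i <= 3)%N.
  by have := valP t; rewrite mem_low => /andP[/eqP].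
have inB' (t : seq_sub B') : mdeg (val t) = (4 - i)%N /\ (4 - i <= 3)%N.
  by have := valP t; rewrite mem_low => /andP[/eqP].
pose b (t : T) : {mpoly K[m + s]} :=
  'X_[match t with inl a => monX (val a) | inr a => star (val a) end].
pose b' (t : T) : {mpoly K[m + s]} :=
  'X_[match t with inl a => star (val a) | inr a => monX (val a) end].
apply: (annihilator_hilb dualform_linear dualform_degree (b := b) (b' := b')).
- case=> t; rewrite dhomogX /=; first by rewrite monX_mdeg (inB t).1.
  by have [dt dt3] := inB' t; rewrite star_mdeg dt //; lia.
- move=> t u; rewrite -mpolyXD; case: t u => [t|t] [u|u].
  + have [[dt _] [du du3]] := (inB t, inB u).
    rewrite addmC dualform_star_yx ?mdeg0 ?addn0 ?dt ?du // eqxx andbT.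
    by congr (nat_of_bool _)%:R; rewrite -val_eqE.
  + rewrite yx_add dualformX addm0; case: eqP => //= /dualvar_mdeg d3.
    by case: eqP => //= E; move: d3; rewrite -E mdeg0.
  + have [[dt dt3] [du du3]] := (inB' t, inB u).
    rewrite yx_add dualformX; case: eqP => //= /dualvar_mdeg d3.
    case: eqP => //= E; move: d3; rewrite -E mdegD !dualvar_mdeg //.
      by rewrite mdeg_corner // du.
    by rewrite mdeg_corner // dt.
  + have [[dt dt3] [du _]] := (inB' t, inB' u).
    rewrite dualform_star_yx ?mdeg0 ?addn0 ?dt ?du // eqxx andbT.
    by congr (nat_of_bool _)%:R; rewrite eq_sym -val_eqE.
move=> mu; have [a [c ->]] := yxP mu; rewrite yx_mdeg => dmu.
have [c1|c1] := ltnP 1%N (mdeg c).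
  by left=> p hp; apply: dualform_mul_eq0 hp _ => la _; apply: dualform_yx_gt1.
have [c0|c0] := eqVneq c 0%MM.
  move: dmu; rewrite c0 mdeg0 addn0 => da.
  have [a3|a3] := leqP (mdeg a) 3.
    have aB' : a \in B' by rewrite mem_low; lia.
    by right; exists (inr (SeqSub aB')) => p _; rewrite mulrC.
  (* A pure [y]-monomial of degree 4 occurs only for [i = 0] and pairs to zero, as every term of the
     dual form contains an [x]. *)
  left=> p hp; apply: dualform_mul_eq0 hp _ => la dla.
  have -> : la = 0%MM by apply/eqP; rewrite -mdeg_eq0; lia.
  by rewrite addm0 dualformX; case: eqP => //; lia.
have dc : mdeg c = 1%N by move: c0; rewrite -mdeg_eq0; lia.
have [g dg cg] : exists2 g, mdeg g = 3 & dualvar g = c.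
  have /mdeg1P[j /eqP ->] : mdeg c == 1%N by rewrite dc.
  exact: dualvar_surj.
(* On degree [i], [y^a x_g] extracts the coefficient of [y^(g-a)]: it acts as [star (g - a)] if [a]
   divides [g], and as zero otherwise. *)
have yxa la : mdeg la = i ->
    dualform 'X_[yx a c + la] = ((a <= g)%MM && (la == yx (g - a) 0%MM))%:R.
  have [a' [b0 ->]] := yxP la; rewrite yx_mdeg yx_add dualformX -cg => dab.
  congr (nat_of_bool _)%:R; apply/idP/idP => [/andP[/eqP d3 /eqP E]|/andP[le_ag /eqP/yx_inj[-> ->]]].
    have b00 : b0 = 0%MM by apply/eqP; rewrite -mdeg_eq0; move: d3; rewrite mdegD; lia.
    move: E; rewrite b00 addm0 => /(dualvar_inj dg d3) ->.
    by rewrite lem_addr addmC addmK eqxx.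
  by rewrite addm0 addmC submK // dg !eqxx.
have [le_ag|nle_ag] := boolP (a <= g)%MM; last first.
  by left=> p hp; apply: dualform_mul_eq0 hp _ => la /yxa ->; rewrite (negPf nle_ag).
have dga : mdeg (g - a) = i.
  by have := congr1 (@mdeg m) (submK le_ag); rewrite mdegD dg; lia.
have gaB : (g - a)%MM \in B by rewrite mem_low dga eqxx; lia.
right; exists (inl (SeqSub gaB)) => p hp; rewrite [p * _]mulrC.
apply: dualform_mul_congr hp _ => la dla; rewrite yxa // le_ag /=.
have [a' [b0 Ela]] := yxP la; move: dla; rewrite Ela yx_mdeg => dab.
rewrite dualform_star_yx ?dga //; last by lia.
congr (nat_of_bool _)%:R; apply/eqP/andP => [/yx_inj[-> ->]|[/eqP -> /eqP ->]] //.
Qed.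

Lemma size_monomials k : size (monomials k) = 'C(k + m', k).
Proof. exact: size_basis. Qed.

Theorem trivial_extension_AG : AG_realizable K (m + 'C(3 + m', 3)) ('C(2 + m', 2) + 'C(2 + m', 2)).
Proof.
exists (m + s)%N, (annihilator dualform); split.
  apply: (annihilator_AG dualform_linear dualform_degree).
  have d3 : mdeg (corner 3 : 'X_{1..m}) = 3 by rewrite mdegMn mdeg1.
  exists 'X_[yx (corner 3) (dualvar (corner 3))]; last by rewrite dualformX d3 !eqxx.
  by rewrite dhomogX /= yx_mdeg dualvar_mdeg ?d3.
have H i d : (i <= 4)%N -> d = (size (low_monomials i) + size (low_monomials (4 - i)))%N ->
    hilb_dim (annihilator dualform) i d.
  by move=> le_i ->; apply: trivial_extension_hilb.
case=> [|[|[|[|[|i]]]]]; last first.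
- by rewrite /= nth_nil; apply: (annihilator_hilb0 dualform_linear dualform_degree).
- by apply: H; rewrite //= size_monomials bin0.
- by apply: H; rewrite //= !size_monomials -[(4 - 3)%N]/1%N bin1 add1n addnC.
- by apply: H; rewrite //= !size_monomials.
- by apply: H; rewrite //= !size_monomials bin1 add1n.
- by apply: H; rewrite //= size_monomials bin0.
Qed.

End TrivialExtension.

Local Close Scope ring_scope.

Theorem theorem3p6 (K : fieldType) (charK0 : [pchar K]%R =i pred0) :
  is_delta K 24 4 /\ is_delta K 40 10.
Proof.
(* Four variables [y] give [r = 4 + 20] and [20 = 2 * 'C(5, 2)]; five give [r = 5 + 35] and
   [30 = 2 * 'C(6, 2)]. The argument [m'] is one less than the number of variables. *)
split; [exists 20 | exists 30]; split=> //; split.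
- exact: (trivial_extension_AG K 3).
- by move=> h; apply: AG_lower_bound => //; vm_compute.
- exact: (trivial_extension_AG K 4).
- by move=> h; apply: AG_lower_bound => //; vm_compute.
Qed.
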